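(* Let $k \ge 1$ be an integer. If $G$ and $H$ are connected graphs, then \[ \gamma_k(G \times H) \ge \gamma_k(G) + \gamma_k(H) - 1, \] where $G \times H$ is the direct product of $G$ and $H$.
   Context: All graphs are finite, simple and undirected. The direct product $G \times H$ is the graph with vertex set $V(G) \times V(H)$ in which $(g_1,h_1)$ and $(g_2,h_2)$ are adjacent if and only if $g_1g_2 \in E(G)$ and $h_1h_2 \in E(H)$. For vertices $u,v$ of a graph $F$, $d_F(u,v)$ is the number of edges of a shortest $(u,v)$-path (infinite if $u$ and $v$ lie in different components; $G\times H$ may be disconnected). A set $S \subseteq V(F)$ is a $k$-dominating set of a graph $F$ if every vertex of $F$ is at distance at most $k$ in $F$ from some vertex of $S$. The $k$-domination number $\gamma_k(F)$ is the minimum cardinality of a $k$-dominating set of $F$. *)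

(* Defs.v *)
From mathcomp Require Import all_boot.

Set Implicit Arguments.
Unset Strict Implicit.
Unset Printing Implicit Defensive.

Record sgraph := SGraph {
  vertex :> finType;
  adj : rel vertex;
  adj_sym : symmetric adj;
  adj_irr : irreflexive adj
}.

(* The graph with no vertices is not connected. *)
Definition connected_graph (G : sgraph) : Prop :=
  0 < #|G| /\ forall u v : G, connect (@adj G) u v.

Section DirectProduct.
Variables G H : sgraph.

Definition dprod_adj : rel (G * H) :=
  fun x y => adj x.1 y.1 && adj x.2 y.2.

Lemma dprod_adj_sym : symmetric dprod_adj.
Proof. by move=> x y; rewrite /dprod_adj adj_sym (adj_sym x.2). Qed.

Lemma dprod_adj_irr : irreflexive dprod_adj.
Proof. by move=> x; rewrite /dprod_adj adj_irr. Qed.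

Definition direct_product : sgraph := SGraph dprod_adj_sym dprod_adj_irr.

End DirectProduct.

Section Domination.
Variable F : sgraph.
Implicit Types (u v : F) (S : {set F}) (k n : nat).

(* The vertex sequence of the path is u :: p, so n counts edges. *)
Definition has_path u v n : bool :=
  [exists p : n.-tuple F,
     [&& path (@adj F) u p, uniq (u :: p) & last u p == v]].

Lemma connect_has_path u v : connect (@adj F) u v -> exists n, has_path u v n.
Proof.
case/connectP=> p0 p0P ->; case/shortenP: p0P => p pP pU _.
by exists (size p); apply/existsP; exists (in_tuple p); rewrite pP pU eqxx.
Qed.

(* None stands for infinite distance. *)
Definition dist u v : option nat :=
  match @idP (connect (@adj F) u v) with
  | ReflectT uv => Some (ex_minn (connect_has_path uv))
  | ReflectF _ => None
  end.

Definition dist_le u v k : bool :=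
  if dist u v is Some d then d <= k else false.

Definition k_dominating k S : bool :=
  [forall v, exists u in S, dist_le v u k].

Lemma dist_refl u : dist u u = Some 0.
Proof.
rewrite /dist; case: {-}_ / idP => [uu|]; last by rewrite connect0.
case: ex_minnP => n _ n_min; congr Some; apply/eqP; rewrite -leqn0.
by apply: n_min; apply/existsP; exists [tuple]; rewrite /= eqxx.
Qed.

Lemma k_dominating_setT k : k_dominating k setT.
Proof.
apply/forallP=> v; apply/existsP; exists v.
by rewrite inE /dist_le dist_refl.
Qed.

(* By k_dominating_setT, the default value setT of arg min satisfies the
   constraint, so this is a genuine minimum. *)
Definition k_domination_number k : nat :=
  #|[arg min_(S < setT | k_dominating k S) #|S|]|.

Lemma k_domination_number_min k :
  (exists2 S, k_dominating k S & #|S| = k_domination_number k) /\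
  (forall S, k_dominating k S -> k_domination_number k <= #|S|).
Proof.
rewrite /k_domination_number; case: arg_minnP; first exact: k_dominating_setT.
by move=> S domS S_min; split=> //; exists S.
Qed.

End Domination.

(* Main.v *)
(** Distances do not increase under projection to a factor. If a k-dominating
    set D of the product had fewer than gamma_k(G) + gamma_k(H) - 1 vertices, it
    would split as D1 + D2 with #|D1| < gamma_k(G) and #|D2| < gamma_k(H). The
    projection of D1 misses some g in G, that of D2 misses some h in H, and then
    (g, h) is not dominated by D. *)

Require Import Defs.
From mathcomp Require Import all_boot.

(** Walks suffice: [shortenP] turns a walk into a path without repeated vertices that is no
    longer. *)
Lemma dist_leP (F : sgraph) (u v : F) (k : nat) :
  reflect (exists p : seq F, [/\ path (@adj F) u p, last u p = v & size p <= k])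
          (dist_le u v k).
Proof.
rewrite /dist_le /dist; case: {-}_ / idP => [uv|nuv]; last first.
  by right=> -[p [pP pv _]]; apply: nuv; apply/connectP; exists p.
apply: (iffP idP); case: ex_minnP => n /existsP[q /and3P[qP _ /eqP qv]] n_min.
  by exists q; split=> //; rewrite size_tuple.
case=> p [pP pv pk]; apply: leq_trans pk.
case/shortenP: pP pv => p' p'P p'U /uniq_leq_size sub_p' p'v.
have size_p' : size p' <= size p by apply: sub_p'; case/andP: p'U.
apply: leq_trans size_p'; apply: n_min.
by apply/existsP; exists (in_tuple p'); rewrite p'P p'U p'v eqxx.
Qed.

(** The image of a path is a walk of the same length; it may repeat vertices, which [dist_leP]
    allows. *)
Lemma dist_le_hom (F F' : sgraph) (f : F -> F') (k : nat) (u v : F) :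
  {homo f : x y / adj x y} -> dist_le u v k -> dist_le (f u) (f v) k.
Proof.
move=> f_hom /dist_leP[p [pP pv pk]]; apply/dist_leP; exists (map f p).
by rewrite last_map pv size_map (homo_path f_hom pP).
Qed.

Lemma k_domination_number_gt0 (F : sgraph) (k : nat) :
  0 < #|F| -> 0 < k_domination_number F k.
Proof.
case/card_gt0P=> v _; have [[S /forallP/(_ v)/exists_inP[u uS _] <-] _] :=
  k_domination_number_min F k.
by apply/card_gt0P; exists u.
Qed.

(** A sequence rather than a set, so that projections with repeated values can be counted by
    length. *)
Lemma undominated_vertex (F : sgraph) (k : nat) (s : seq F) :
  size s < k_domination_number F k ->
  exists v, {in s, forall u, ~~ dist_le v u k}.
Proof.
move=> s_lt; have [_ F_min] := k_domination_number_min F k.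
have : ~~ k_dominating k [set u in s].
  apply/negP => /F_min; rewrite cardsE leqNgt => /negP; apply.
  exact: leq_ltn_trans (card_size s) s_lt.
case/forallPn=> v /exists_inPn v_far; exists v => u us.
by apply: v_far; rewrite inE.
Qed.

Theorem theorem14 (k : nat) (hk : 1 <= k) (G H : sgraph)
    (hG : connected_graph G) (hH : connected_graph H) :
  k_domination_number (direct_product G H) k >=
    k_domination_number G k + k_domination_number H k - 1.
Proof.
have [[D /forallP domD <-] _] := k_domination_number_min (direct_product G H) k.
have [G_gt0 H_gt0] : 0 < k_domination_number G k /\ 0 < k_domination_number H k.
  by split; apply: k_domination_number_gt0; [case: hG | case: hH].
rewrite leqNgt; apply/negP => D_lt.
set n := (k_domination_number G k).-1.
have [|g g_far] := @undominated_vertex G k (map fst (take n (enum D))).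
  by rewrite size_map size_take_min -(ltn_predK G_gt0) ltnS geq_minl.
have [|h h_far] := @undominated_vertex H k (map snd (drop n (enum D))).
  (* [D_lt] says [#|D| < n + k_domination_number H k]; [H_gt0] covers the truncated case
     [#|D| <= n]. *)
  by rewrite size_map size_drop -cardE ltn_psubLR // /n -subn1 addnBAC.
have /exists_inP[x xD gh_x] := domD (g, h).
have : x \in take n (enum D) ++ drop n (enum D) by rewrite cat_take_drop mem_enum.
rewrite mem_cat => /orP[x1 | x2].
  have /negP := g_far _ (map_f fst x1); apply.
  (* Product adjacency is a conjunction, so each projection preserves it. *)
  by apply: (@dist_le_hom (direct_product G H) G fst k _ _ _ gh_x) => y z /andP[].
have /negP := h_far _ (map_f snd x2); apply.
by apply: (@dist_le_hom (direct_product G H) H snd k _ _ _ gh_x) => y z /andP[].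
Qed.
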